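(* Under the assumptions of Theorem 2.5 (i.e. $B$ centered Gaussian with stationary increments, $B_0=0$, $X_t=\theta t+B_t$, $h>0$, $(B_{kh})_{k=1}^N$ nonsingular for every $N$, and $\mathbb{E}[(B_{(k+1)h}-B_{kh})B_h]\to0$ as $k\to\infty$), the maximum likelihood estimator $$\hat\theta^{(N)}=\frac{z^\top(\Gamma^{(N)})^{-1}\Delta X^{(N)}}{z^\top(\Gamma^{(N)})^{-1}z},\qquad z=(h,\dots,h)^\top\in\mathbb{R}^N,$$ is strongly consistent: $\hat\theta^{(N)}\to\theta$ almost surely as $N\to\infty$.
   Context: $\Delta X^{(N)}=(X_{kh}-X_{(k-1)h})_{k=1}^N$, $\Delta B^{(N)}=(B_{kh}-B_{(k-1)h})_{k=1}^N$, and $\Gamma^{(N)}$ is the covariance matrix of $\Delta B^{(N)}$; all estimators are defined on the same probability space from a single trajectory of $X$. *)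

(* Defs.v *)
From HB Require Import structures.
From mathcomp Require Import all_boot all_order all_algebra.
From mathcomp Require Import all_classical all_reals all_analysis.
Set Implicit Arguments. Unset Strict Implicit. Unset Printing Implicit Defensive.
Import Order.TTheory GRing.Theory Num.Theory.
Import numFieldNormedType.Exports.
Local Open Scope classical_set_scope.
Local Open Scope ring_scope.

Section Defs.
Context {d : measure_display} {T : measurableType d} {R : realType}.
Variable P : probability T R.

Definition has_gaussian_law (X : T -> R) (m v : R) : Prop :=
  0 <= v /\
  forall A : set R, measurable A ->
    P (X @^-1` A) = (if v == 0 then \d_m A else normal_prob m (Num.sqrt v) A).

Definition lincomb (B : R -> {RV P >-> R}) (n : nat) (t c : 'I_n -> R) : T -> R :=
  fun w => \sum_(i < n) c i * B (t i) w.

Definition centered_gaussian_process (B : R -> {RV P >-> R}) : Prop :=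
  forall (n : nat) (t c : 'I_n -> R), (forall i, 0 <= t i) ->
    exists v : R, has_gaussian_law (lincomb B t c) 0 v.

(* Stationary increments: for every s >= 0 the process (B_{t+s} - B_s)_{t>=0}
   has the same finite-dimensional distributions as (B_t)_{t>=0}; the equality
   of finite-dimensional laws is expressed through all linear combinations
   (Cramer-Wold). *)
Definition stationary_increments (B : R -> {RV P >-> R}) : Prop :=
  forall (s : R), 0 <= s -> forall (n : nat) (t c : 'I_n -> R),
    (forall i, 0 <= t i) ->
    forall A : set R, measurable A ->
      P ((fun w => \sum_(i < n) c i * (B (t i + s) w - B s w)) @^-1` A)
      = P (lincomb B t c @^-1` A).

Definition Xproc (theta : R) (B : R -> {RV P >-> R}) (t : R) : T -> R :=
  fun w => theta * t + B t w.

Definition incB (B : R -> {RV P >-> R}) (h : R) (k : nat) : T -> R :=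
  fun w => B (k.+1%:R * h) w - B (k%:R * h) w.

Definition DeltaX (theta : R) (B : R -> {RV P >-> R}) (h : R) (N : nat) (w : T)
  : 'cV[R]_N :=
  \col_(k < N) (Xproc theta B (k.+1%:R * h) w - Xproc theta B (k%:R * h) w).

Definition Gamma (B : R -> {RV P >-> R}) (h : R) (N : nat) : 'M[R]_N :=
  \matrix_(i < N, j < N) fine (covariance P (incB B h i) (incB B h j)).

Definition covB (B : R -> {RV P >-> R}) (h : R) (N : nat) : 'M[R]_N :=
  \matrix_(i < N, j < N)
    fine (covariance P (B (i.+1%:R * h)) (B (j.+1%:R * h))).

Definition zvec (h : R) (N : nat) : 'cV[R]_N := const_mx h.

Definition mle (theta : R) (B : R -> {RV P >-> R}) (h : R) (N : nat) (w : T) : R :=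
  ((zvec h N)^T *m invmx (Gamma B h N) *m DeltaX theta B h N w) 0 0
  / ((zvec h N)^T *m invmx (Gamma B h N) *m zvec h N) 0 0.

End Defs.

(* Main.v *)
Require Import Defs.
From HB Require Import structures.
From mathcomp Require Import all_boot all_order all_algebra.
From mathcomp Require Import all_classical all_reals all_analysis.
From mathcomp Require Import measurable_realfun ring lra.
Set Implicit Arguments.
Unset Strict Implicit.
Unset Printing Implicit Defensive.
Import Order.TTheory GRing.Theory Num.Theory.
Import numFieldNormedType.Exports.
Local Open Scope classical_set_scope.
Local Open Scope ring_scope.

(**
  Write xi_k for the increments of B, S_N for the estimation error (the
  estimator minus theta), and v_N = 1 / (z^T Gamma^-1 z) for its variance.  The
  normal equations E[xi_k S_N] = v_N h (k < N) give E[S_i S_j] = v_j for i <= j,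
  hence E[(S_i - S_j)^2] = v_i - v_j, and by Cauchy-Schwarz v_N is at most the
  variance of the sample mean, which tends to 0 by Cesaro.

  Independence of the Gaussian increments of S is never used: it suffices that
  the fourth moment of a centered Gaussian is bounded by a multiple of its
  squared variance, so that E[(S_i - S_j)^4] <= K (v_i - v_j)^2.  The exponent
  2 > 1 on the right makes Billingsley's maximal inequality available for
  arbitrarily dependent variables; applied between the terms of a subsequence
  along which v decreases geometrically, it yields almost sure convergence.
*)

(** * Moments of the centered normal distribution *)

Section GaussianMoments.
Context {R : realType}.
Local Notation mu := (@lebesgue_measure R).

(** The Radon-Nikodym derivative of [normal_prob] agrees almost everywhere with the density, since
    both have the same integral over every measurable set. *)
Lemma ge0_integral_normal_prob (s : R) (f : R -> \bar R) :
  measurable_fun setT f -> (forall x, 0 <= f x)%E ->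
  (\int[normal_prob 0 s]_x f x = \int[mu]_x (f x * (normal_pdf 0 s x)%:E))%E.
Proof.
move=> mf f0.
have dom := @normal_prob_dominates R 0 s.
rewrite -(Radon_Nikodym_SigmaFinite.change_of_variables dom)//.
have mg := measurable_int _ (Radon_Nikodym_SigmaFinite.f_integrable dom).
apply: ae_eq_integral => //.
- exact: emeasurable_funM.
- apply: emeasurable_funM => //.
  by apply/measurable_EFinP; exact: measurable_normal_pdf.
- apply: ae_eqe_mul2l; apply: integral_ae_eq => //.
  + exact: Radon_Nikodym_SigmaFinite.f_integrable.
  + by apply/measurable_EFinP; exact: measurable_normal_pdf.
  + by move=> A _ mA; rewrite -Radon_Nikodym_SigmaFinite.f_integral.
Qed.

Lemma normal_pdf_sym (s x : R) : s != 0 -> normal_pdf 0 s (- x) = normal_pdf 0 s x.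
Proof. by move=> s0; rewrite normal_pdfE// /normal_fun !subr0 sqrrN. Qed.

Lemma integral_normal_posneg (s : R) : s != 0 ->
  (\int[normal_prob 0 s]_x (Num.max x 0)%:E =
   \int[normal_prob 0 s]_x (Num.max (- x) 0)%:E)%E.
Proof.
move=> s0.
have mM : measurable_fun setT (fun x : R => Num.max x 0) by apply: measurable_maxr.
have mN : measurable_fun setT (fun x : R => Num.max (- x) 0).
  by apply: measurable_maxr => //; apply: measurable_funN.
rewrite !ge0_integral_normal_prob//; last 4 first.
- exact/measurable_EFinP.
- by move=> x; rewrite lee_fin le_max lexx orbT.
- exact/measurable_EFinP.
- by move=> x; rewrite lee_fin le_max lexx orbT.
(* Each integrand vanishes on one side of 0, so the two integrals live on half-lines exchanged by x
   -> -x, and the density is even. *)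
have half (g : R -> R) (D : set R) : measurable D ->
  (forall x, ~ D x -> g x = 0) ->
  (\int[mu]_x ((g x)%:E * (normal_pdf 0 s x)%:E) =
   \int[mu]_(x in D) (g x * normal_pdf 0 s x)%:E)%E.
  move=> mD gD; rewrite [RHS]integral_mkcond; apply: eq_integral => x _.
  rewrite patchE; case: ifPn => // /negP xD.
  by rewrite gD ?mul0e// => Dx; apply: xD; rewrite inE.
rewrite (half _ `[0, +oo[%classic)//; last first.
  move=> x /=; rewrite in_itv/= andbT => /negP; rewrite -ltNge => x0.
  by rewrite max_r// ltW.
(* The endpoint is written [- 0] to match the image of the half-line from 0 under the
   substitution. *)
rewrite (half _ `]-oo, (- 0)]%classic)//; last first.
  move=> x /=; rewrite oppr0 in_itv/= => /negP; rewrite -ltNge => x0.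
  by rewrite max_r// oppr_le0 ltW.
rewrite ge0_integration_by_substitutionNy.
- by apply: eq_integral => x _ /=; rewrite opprK normal_pdf_sym.
- apply: continuous_subspaceT => x.
  apply: cvgM; last exact: continuous_normal_pdf.
  apply: (@continuous_comp _ _ _ (@GRing.opp R) (fun y => Num.max y 0)).
    exact: continuousN.
  apply: continuous_max => //; exact: cst_continuous.
- move=> x _; apply: mulr_ge0; last exact: normal_pdf_ge0.
  by rewrite le_max lexx orbT.
Qed.

(** Quadratic term of the exponential series at x^2/4. This is half of the Gaussian exponent x^2/2,
    so absorbing it leaves a Gaussian factor of twice the variance. *)
Lemma expr4_le_expR (x : R) : x ^+ 4 <= 32 * expR (x ^+ 2 / 4).
Proof.
have := @expR_ge1Dxn R (x ^+ 2 / 4) 1 (divr_ge0 (sqr_ge0 x) (ler0n _ _)).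
have -> : (2`!%:R : R) = 2 by [].
move=> H.
have -> : x ^+ 4 = 32 * ((x ^+ 2 / 4) ^+ 2 / 2) by field.
rewrite ler_pM2l ?ltr0n//; apply: le_trans H; lra.
Qed.

(** Pointwise, x^4 times the density of variance s^2 is at most a constant times the density of
    variance 2 s^2, which has total mass 1. *)
Lemma normal_fourth_moment_le (s : R) : 0 < s ->
  (\int[normal_prob 0 s]_x (x ^+ 4)%:E <= (32 * Num.sqrt 2 * s ^+ 4)%:E)%E.
Proof.
move=> s0.
have s20 : Num.sqrt 2 * s != 0 by rewrite mulf_neq0 ?gt_eqF// sqrtr_gt0.
rewrite ge0_integral_normal_prob//; last 2 first.
- by apply/measurable_EFinP; apply: measurable_funX.
- by move=> x; rewrite lee_fin exprn_even_ge0.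
have -> : (32 * Num.sqrt 2 * s ^+ 4)%:E =
  (\int[mu]_x ((32 * Num.sqrt 2 * s ^+ 4)%:E *
     (normal_pdf 0 (Num.sqrt 2 * s) x)%:E) :> \bar R)%E.
  rewrite ge0_integralZl//.
  - by rewrite integral_normal_pdf mule1.
  - by apply/measurable_EFinP; exact: measurable_normal_pdf.
  - by move=> x _; rewrite lee_fin normal_pdf_ge0.
  - by rewrite lee_fin !mulr_ge0 ?sqrtr_ge0// ltW.
apply: ge0_le_integral => //.
- move=> x _; rewrite mule_ge0// lee_fin ?normal_pdf_ge0//.
  by rewrite exprn_even_ge0.
- apply/measurable_EFinP; apply: measurable_funM; first exact: measurable_funX.
  exact: measurable_normal_pdf.
- apply/measurable_EFinP; apply: measurable_funM => //.
  exact: measurable_normal_pdf.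
move=> x _; rewrite -!EFinM lee_fin !normal_pdfE ?(gt_eqF s0)//.
(* Doubling the variance divides the peak by the square root of 2; the exponential factor left over,
   [e] below, absorbs x^4. *)
have pk : normal_peak (Num.sqrt 2 * s) = (Num.sqrt 2)^-1 * normal_peak s.
  rewrite /normal_peak exprMn sqr_sqrtr// -mulrA -mulrnAr.
  by rewrite sqrtrM// invfM.
have fn : normal_fun 0 s x = expR (- (x ^+ 2 / s ^+ 2 / 4)) * normal_fun 0 (Num.sqrt 2 * s) x.
  rewrite /normal_fun -expRD; congr expR.
  rewrite !subr0 exprMn sqr_sqrtr//; field.
  by rewrite gt_eqF.
rewrite pk fn.
have /(_ (x / s)) := expr4_le_expR.
rewrite !expr_div_n ler_pdivrMr ?exprn_gt0// => H.
have sq2 : Num.sqrt 2 * (Num.sqrt 2)^-1 = 1 :> R.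
  by rewrite divff// gt_eqF// sqrtr_gt0.
set e := expR (- _); set g := normal_fun _ _ _.
have -> : 32 * Num.sqrt 2 * s ^+ 4 * ((Num.sqrt 2)^-1 * normal_peak s * g) =
  (Num.sqrt 2 * (Num.sqrt 2)^-1) * (32 * s ^+ 4 * (normal_peak s * g)) by ring.
rewrite sq2 mul1r.
have -> : x ^+ 4 * (normal_peak s * (e * g)) = (x ^+ 4 * e) * (normal_peak s * g).
  by ring.
apply: ler_wpM2r; first by rewrite mulr_ge0 ?normal_peak_ge0 ?normal_fun_ge0.
by rewrite /e expRN ler_pdivrMr ?expR_gt0// mulrAC.
Qed.

(* Half of the mass of N(0, s^2) lies outside [-s/4, s/4], since the density is
   at most 1/s. *)
Lemma normal_second_moment_ge (s : R) : 0 < s ->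
  ((s ^+ 2 / 32)%:E <= \int[normal_prob 0 s]_x (x ^+ 2)%:E)%E.
Proof.
move=> s0.
pose I := `[- (s / 4), s / 4]%classic : set R.
have mI : measurable I by exact: measurable_itv.
have pkle : normal_peak s <= s^-1.
  rewrite /normal_peak lef_pV2 ?posrE ?sqrtr_gt0//; last first.
    by rewrite pmulrn_lgt0// mulr_gt0 ?exprn_gt0 ?pi_gt0.
  rewrite -[leLHS](ger0_norm (ltW s0)) -sqrtr_sqr; apply: ler_wsqrtr.
  rewrite -mulrnAr ler_peMr ?sqr_ge0//.
  by have := @pi_ge2 R; rewrite mulr2n; lra.
have NI : (normal_prob 0 s I <= (2^-1)%:E)%E.
  rewrite /normal_prob.
  apply: (@le_trans _ _ (\int[mu]_(x in I) (cst (s^-1)%:E) x)%E).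
    apply: ge0_le_integral => //.
    - by move=> x _; rewrite lee_fin normal_pdf_ge0.
    - apply: measurable_funTS; apply/measurable_EFinP.
      exact: measurable_normal_pdf.
    - move=> x _; rewrite lee_fin (le_trans _ pkle)// normal_pdf_ub//.
      by rewrite gt_eqF.
  rewrite integral_cst//= /I lebesgue_measure_itv/= lte_fin ifT; last by lra.
  rewrite -EFinD -EFinM lee_fin opprK.
  suff -> : s^-1 * (s / 4 + s / 4) = 2^-1 by [].
  by field; rewrite gt_eqF.
have NC : ((2^-1)%:E <= normal_prob 0 s (~` I))%E.
  rewrite probability_setC//.
  rewrite leeBrDr; last by rewrite fin_num_measure.
  apply: (@le_trans _ _ ((2^-1)%:E + (2^-1)%:E)%E); first by rewrite leeD2l.
  by rewrite -EFinD lee_fin; lra.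
apply: (@le_trans _ _ (\int[normal_prob 0 s]_(x in ~` I) (cst (s ^+ 2 / 16)%:E) x)%E).
  rewrite integral_cst//; last exact: measurableC.
  apply: le_trans (_ : (s ^+ 2 / 16)%:E * (2^-1)%:E <= _)%E; last first.
    by rewrite lee_pmul2l// lte_fin divr_gt0 ?exprn_gt0.
  by rewrite -EFinM lee_fin; lra.
apply: (@le_trans _ _ (\int[normal_prob 0 s]_(x in ~` I) (x ^+ 2)%:E)%E); last first.
  apply: ge0_subset_integral => //; first exact: measurableC.
    by apply/measurable_EFinP; apply: measurable_funX.
  by move=> x _; rewrite lee_fin sqr_ge0.
apply: ge0_le_integral => //.
- exact: measurableC.
- by move=> x _; rewrite lee_fin divr_ge0 ?sqr_ge0.
- by apply/measurable_EFinP; apply: measurable_funTS; apply: measurable_funX.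
- move=> x /= /negP; rewrite in_itv/= -ler_norml -ltNge => sx.
  have -> : s ^+ 2 / 16 = (s / 4) ^+ 2 by field.
  by rewrite lee_fin -[leRHS]real_normK ?num_real// ler_pXn2r ?nnegrE// ltW// divr_gt0.
Qed.

End GaussianMoments.

(** * Fourth-moment integrability and centered Gaussian laws *)

Section FourthMoments.
Context {d : measure_display} {T : measurableType d} {R : realType}.
Variable P : probability T R.

(** A single integrability class: it is stable under linear combinations and, P being finite, makes
    products of two members integrable. *)
Definition L4 (f : T -> R) : Prop :=
  measurable_fun setT f /\ P.-integrable setT (fun w => (f w ^+ 4)%:E).

(** The L2 inner product as a real number. An infinite integral would be read as 0, whence the [L4]
    assumptions in the bilinearity lemmas. *)
Definition ip (f g : T -> R) : R := \int[P]_w (f w * g w).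

Lemma L4_cst (a : R) : L4 (fun=> a).
Proof.
by split => //; exact: (finite_measure_integrable_cst P).
Qed.

Lemma L4_scale (a : R) (f : T -> R) : L4 f -> L4 (fun w => a * f w).
Proof.
move=> [mf intf]; split; first exact: measurable_funM.
apply: eq_integrable (integrableZl measurableT (a ^+ 4) intf) => //.
by move=> w _; rewrite -EFinM exprMn.
Qed.

(** Convexity of the fourth power, certified by sums of squares; the constant is 2^3. *)
Lemma exprD4_le (a b : R) : (a + b) ^+ 4 <= 8 * (a ^+ 4 + b ^+ 4).
Proof.
rewrite -subr_ge0.
have -> : 8 * (a ^+ 4 + b ^+ 4) - (a + b) ^+ 4 =
  3 * (a ^+ 2 - b ^+ 2) ^+ 2 + (a - b) ^+ 2 * (4 * a ^+ 2 + 4 * a * b + 4 * b ^+ 2) .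
  by ring.
apply: addr_ge0; first by rewrite mulr_ge0 ?sqr_ge0//.
apply: mulr_ge0; first exact: sqr_ge0.
have -> : 4 * a ^+ 2 + 4 * a * b + 4 * b ^+ 2 = (2 * a + b) ^+ 2 + 3 * b ^+ 2 by ring.
by have := sqr_ge0 (2 * a + b); have := sqr_ge0 b; lra.
Qed.

Lemma L4_add (f g : T -> R) : L4 f -> L4 g -> L4 (fun w => f w + g w).
Proof.
move=> [mf intf] [mg intg]; split; first exact: measurable_funD.
apply: le_integrable (integrableZl measurableT 8 (integrableD measurableT intf intg)) => //.
  by apply/measurable_EFinP; apply: measurable_funX; exact: measurable_funD.
move=> w _; rewrite -EFinD -EFinM !abse_EFin lee_fin.
rewrite !ger0_norm ?exprD4_le ?exprn_even_ge0//.
by rewrite mulr_ge0// addr_ge0// exprn_even_ge0.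
Qed.

Lemma L4_sum (I : Type) (s : seq I) (F : I -> T -> R) :
  (forall i, L4 (F i)) -> L4 (fun w => \sum_(i <- s) F i w).
Proof.
move=> FL; elim: s => [|i s IH].
  by under eq_fun do rewrite big_nil; exact: L4_cst.
by under eq_fun do rewrite big_cons; exact: L4_add.
Qed.

(** Domination of |f g| by f^4 + g^4 + 1, whose constant term is integrable because P is finite. *)
Lemma L4_integrableM (f g : T -> R) :
  L4 f -> L4 g -> P.-integrable setT (EFin \o (fun w => f w * g w)).
Proof.
move=> [mf intf] [mg intg].
have int1 : P.-integrable setT (EFin \o (fun=> 1 : R)).
  exact: (finite_measure_integrable_cst P).
apply: le_integrable (integrableD measurableT (integrableD measurableT intf intg) int1) => //.
  by apply/measurable_EFinP; exact: measurable_funM.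
move=> w _; rewrite /= lee_fin [leRHS]ger0_norm; last first.
  by rewrite !addr_ge0// exprn_even_ge0.
rewrite normrM.
have -> : f w ^+ 4 = `|f w| ^+ 4 by rewrite -normrX ger0_norm// exprn_even_ge0.
have -> : g w ^+ 4 = `|g w| ^+ 4 by rewrite -normrX ger0_norm// exprn_even_ge0.
move: `|f w| `|g w| => a b.
(* These squares encode ab <= (a^2 + b^2)/2 and t <= t^2 + 1/4 at t = a^2 and t = b^2. *)
have := sqr_ge0 (a - b); have := sqr_ge0 (a ^+ 2 - 2^-1).
have := sqr_ge0 (b ^+ 2 - 2^-1); nra.
Qed.

Lemma L4_integrable (f : T -> R) : L4 f -> P.-integrable setT (EFin \o f).
Proof.
move=> Lf; have := L4_integrableM Lf (L4_cst 1).
by apply: eq_integrable => // w _ /=; rewrite mulr1.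
Qed.

Lemma ipC (f g : T -> R) : ip f g = ip g f.
Proof. by apply: eq_Rintegral => w _; rewrite mulrC. Qed.

Lemma ip_ge0 (f : T -> R) : 0 <= ip f f.
Proof. by apply: Rintegral_ge0 => w _; rewrite -expr2 sqr_ge0. Qed.

Lemma ipDr (f g k : T -> R) : L4 f -> L4 g -> L4 k ->
  ip f (fun w => g w + k w) = ip f g + ip f k.
Proof.
move=> Lf Lg Lk; rewrite -RintegralD//; try exact: L4_integrableM.
by apply: eq_Rintegral => w _; rewrite mulrDr.
Qed.

Lemma ipZr (a : R) (f g : T -> R) : L4 f -> L4 g ->
  ip f (fun w => a * g w) = a * ip f g.
Proof.
move=> Lf Lg; rewrite -RintegralZl//; try exact: L4_integrableM.
by apply: eq_Rintegral => w _; rewrite mulrCA.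
Qed.

Lemma ip_sumr (I : Type) (s : seq I) (a : I -> R) (f : T -> R) (F : I -> T -> R) :
  L4 f -> (forall i, L4 (F i)) ->
  ip f (fun w => \sum_(i <- s) a i * F i w) = \sum_(i <- s) a i * ip f (F i).
Proof.
move=> Lf LF; elim: s => [|i s IH].
  rewrite big_nil -[RHS](mul0r (ip f (fun=> 0))) -ipZr//; last exact: L4_cst.
  by apply: eq_Rintegral => w _; rewrite big_nil mul0r.
rewrite big_cons -IH -ipZr// -ipDr//.
- by apply: eq_Rintegral => w _; rewrite big_cons.
- exact: L4_scale.
- by apply: L4_sum => j; exact: L4_scale.
Qed.

(** Push-forward along [X], whose distribution agrees on measurable sets with a Dirac mass (v = 0)
    or a normal measure. *)
Lemma gaussian_law_integral (X : T -> R) (v : R) (f : R -> \bar R) :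
  measurable_fun setT X -> has_gaussian_law P X 0 v ->
  measurable_fun setT f -> (forall x, 0 <= f x)%E ->
  (\int[P]_w f (X w) =
   if v == 0%R then f 0%R else \int[normal_prob 0 (Num.sqrt v)]_x f x)%E.
Proof.
move=> mX [_ lawX] mf f0.
pose X' : {mfun T >-> measurableTypeR R} :=
  HB.pack X (isMeasurableFun.Build _ _ T (measurableTypeR R) X mX).
rewrite -(@ge0_integral_distribution _ _ T (measurableTypeR R) R P X' f)//.
case: eqP lawX => [_|_] lawX.
  rewrite -[RHS](_ : \int[\d_(0%R : measurableTypeR R)]_x f x = _)%E; last first.
    by rewrite integral_dirac// diracE in_setT mul1e.
  by apply: eq_measure_integral => A mA _; exact: lawX.
by apply: eq_measure_integral => A mA _; exact: lawX.
Qed.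

Lemma gaussian_law_L4 (X : T -> R) (v : R) :
  measurable_fun setT X -> has_gaussian_law P X 0 v -> L4 X.
Proof.
move=> mX lawX; split => //; apply/integrableP; split.
  by apply/measurable_EFinP; exact: measurable_funX.
under eq_integral do rewrite abse_EFin ger0_norm ?exprn_even_ge0//.
rewrite (gaussian_law_integral (f := fun x => (x ^+ 4)%:E) mX lawX); last 2 first.
- by apply/measurable_EFinP; exact: measurable_funX.
- by move=> x; rewrite lee_fin exprn_even_ge0.
case: eqP => [_|/eqP v0]; first exact: ltry.
apply: le_lt_trans (normal_fourth_moment_le _) (ltry _).
by rewrite sqrtr_gt0 lt_neqAle eq_sym v0 (proj1 lawX).
Qed.

(** The transfer formula concerns nonnegative functions, so the positive and negative parts are
    integrated separately; they agree by symmetry and are finite by [L4]. *)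
Lemma gaussian_law_mean (X : T -> R) (v : R) :
  measurable_fun setT X -> has_gaussian_law P X 0 v -> \int[P]_w X w = 0.
Proof.
move=> mX lawX.
have iX := L4_integrable (gaussian_law_L4 mX lawX).
have mp : measurable_fun setT (fun x : R => Num.max x 0).
  by apply: measurable_maxr.
have mn : measurable_fun setT (fun x : R => Num.max (- x) 0).
  by apply: measurable_maxr => //; exact: measurable_funN.
have H : (\int[P]_w (Num.max (X w) 0)%:E = \int[P]_w (Num.max (- X w) 0)%:E)%E.
  rewrite (gaussian_law_integral (f := fun x => (Num.max x 0)%:E) mX lawX); last 2 first.
  - exact/measurable_EFinP.
  - by move=> x; rewrite lee_fin le_max lexx orbT.
  rewrite (gaussian_law_integral (f := fun x => (Num.max (- x) 0)%:E) mX lawX); last 2 first.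
  - exact/measurable_EFinP.
  - by move=> x; rewrite lee_fin le_max lexx orbT.
  case: eqP => [_|/eqP v0]; first by rewrite oppr0.
  apply: integral_normal_posneg.
  by rewrite gt_eqF// sqrtr_gt0 lt_neqAle eq_sym v0 (proj1 lawX).
have bnd (g : T -> R) : measurable_fun setT g -> (forall w, `|g w| <= `|X w|) ->
    P.-integrable setT (EFin \o g).
  move=> mg gX; apply: le_integrable iX => //; first exact/measurable_EFinP.
  by move=> w _; rewrite /= lee_fin; exact: gX.
have intp : P.-integrable setT (EFin \o (fun w => Num.max (X w) 0)).
  apply: bnd; first exact: measurable_maxr.
  by move=> w; case: (leP (X w) 0) => //; rewrite normr0.
have intn : P.-integrable setT (EFin \o (fun w => Num.max (- X w) 0)).
  apply: bnd; first by apply: measurable_maxr => //; exact: measurable_funN.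
  by move=> w; case: (leP (- X w) 0) => //; rewrite ?normr0 ?normrN.
have -> : \int[P]_w X w = \int[P]_w (Num.max (X w) 0 - Num.max (- X w) 0).
  apply: eq_Rintegral => w _; case: (leP (X w) 0) => Xw.
    by rewrite max_l ?oppr_ge0// sub0r opprK.
  by rewrite max_r ?subr0// oppr_le0 ltW.
by rewrite RintegralB// /Rintegral H subrr.
Qed.

(** Expressing the bound through [ip P X X] rather than [v] lets crude estimates of the fourth and
    second moments be combined. *)
Lemma gaussian_law_hypercontractive (X : T -> R) (v : R) :
  measurable_fun setT X -> has_gaussian_law P X 0 v ->
  \int[P]_w (X w ^+ 4) <= (256 * ip X X) ^+ 2.
Proof.
move=> mX lawX.
have L := gaussian_law_L4 mX lawX.
case: (eqVneq v 0) => [v0|v0].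
  have -> : \int[P]_w (X w ^+ 4) = 0.
    rewrite /Rintegral (gaussian_law_integral (f := fun x => (x ^+ 4)%:E) mX lawX).
    - by rewrite v0 eqxx expr0n.
    - by apply/measurable_EFinP; exact: measurable_funX.
    - by move=> x; rewrite lee_fin exprn_even_ge0.
  by rewrite sqr_ge0.
have s0 : 0 < Num.sqrt v.
  by rewrite sqrtr_gt0 lt_neqAle eq_sym v0 (proj1 lawX).
set s := Num.sqrt v in s0.
have E4 : \int[P]_w (X w ^+ 4) <= 32 * Num.sqrt 2 * s ^+ 4.
  rewrite -lee_fin /Rintegral fineK; last exact: integrable_fin_num (proj2 L).
  rewrite (gaussian_law_integral (f := fun x => (x ^+ 4)%:E) mX lawX) ?(negbTE v0).
  - exact: normal_fourth_moment_le.
  - by apply/measurable_EFinP; exact: measurable_funX.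
  - by move=> x; rewrite lee_fin exprn_even_ge0.
have E2 : s ^+ 2 / 32 <= ip X X.
  rewrite -lee_fin /ip /Rintegral fineK; last exact: integrable_fin_num (L4_integrableM L L).
  under eq_integral do rewrite -expr2.
  rewrite (gaussian_law_integral (f := fun x => (x ^+ 2)%:E) mX lawX) ?(negbTE v0).
  - exact: normal_second_moment_ge.
  - by apply/measurable_EFinP; exact: measurable_funX.
  - by move=> x; rewrite lee_fin sqr_ge0.
apply: le_trans E4 _.
have sq2 : Num.sqrt 2 <= 2 :> R.
  by rewrite -[leRHS]ger0_norm// -sqrtr_sqr; apply: ler_wsqrtr; lra.
(* The fourth moment is at most 64 s^4 = (8 s^2)^2, and s^2 <= 32 E[X^2]; hence the constant 8 * 32
   = 256. *)
apply: (@le_trans _ _ ((8 * s ^+ 2) ^+ 2)).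
  have -> : (8 * s ^+ 2) ^+ 2 = 32 * 2 * s ^+ 4 by ring.
  by rewrite ler_pM2r ?exprn_gt0// ler_pM2l.
rewrite ler_pXn2r ?nnegrE ?mulr_ge0 ?sqr_ge0 ?ip_ge0//; lra.
Qed.

End FourthMoments.

(** * Maximal inequality for quartic increments *)

Section MaximalInequality.
Context {d : measure_display} {T : measurableType d} {R : realType}.
Variable P : probability T R.

(** The weighted inequality (x + y)^2 <= 9 x^2 + (9/8) y^2 is applied twice; the second coefficient
    becomes (9/8)^3 < 3/2. *)
Lemma exprD4_le_weighted : exists2 c : R, 0 <= c &
  forall a b : R, (a + b) ^+ 4 <= c * a ^+ 4 + 3 / 2 * b ^+ 4.
Proof.
exists (9 ^+ 3) => [|a b]; first by rewrite exprn_ge0.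
have sq (x y : R) : (x + y) ^+ 2 <= 9 * x ^+ 2 + 9 / 8 * y ^+ 2.
  by have := sqr_ge0 (x - y / 8); lra.
have -> : (a + b) ^+ 4 = ((a + b) ^+ 2) ^+ 2 by ring.
apply: le_trans (_ : (9 * a ^+ 2 + 9 / 8 * b ^+ 2) ^+ 2 <= _).
  by rewrite ler_pXn2r ?nnegrE ?sqr_ge0 ?(le_trans _ (sq a b)) ?sqr_ge0.
apply: le_trans (sq _ _) _.
have -> : 9 * (9 * a ^+ 2) ^+ 2 = 9 ^+ 3 * a ^+ 4 by ring.
rewrite lerD2l.
have -> : 9 / 8 * (9 / 8 * b ^+ 2) ^+ 2 = (9 / 8) ^+ 3 * b ^+ 4 by ring.
by rewrite ler_wpM2r ?exprn_even_ge0//; lra.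
Qed.

Lemma ge0_integral_linear (f g : T -> R) (a b : R) :
  measurable_fun setT f -> measurable_fun setT g ->
  (forall w, 0 <= f w) -> (forall w, 0 <= g w) -> 0 <= a -> 0 <= b ->
  (\int[P]_w (a * f w + b * g w)%:E =
   a%:E * \int[P]_w (f w)%:E + b%:E * \int[P]_w (g w)%:E)%E.
Proof.
move=> mf mg f0 g0 a0 b0.
under eq_integral do rewrite EFinD !EFinM.
have mf' : measurable_fun setT (EFin \o f) by exact/measurable_EFinP.
have mg' : measurable_fun setT (EFin \o g) by exact/measurable_EFinP.
rewrite ge0_integralD//.
- congr (_ + _)%E; apply: ge0_integralZl => //.
  + by move=> w _; rewrite lee_fin.
  + by move=> w _; rewrite lee_fin.
- by move=> w _; rewrite mule_ge0 ?lee_fin.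
- exact: emeasurable_funM.
- by move=> w _; rewrite mule_ge0 ?lee_fin.
- exact: emeasurable_funM.
Qed.

Variables (S : nat -> T -> R) (v : nat -> R) (K c : R).
Hypothesis L4S : forall i, L4 P (S i).
Hypothesis v_noninc : forall i j, (i <= j)%N -> v j <= v i.
Hypothesis K0 : 0 <= K.
Hypothesis c0 : 0 <= c.
Hypothesis exprD4_le_c :
  forall a b : R, (a + b) ^+ 4 <= c * a ^+ 4 + 3 / 2 * b ^+ 4.
Hypothesis incr : forall i j, (i <= j)%N ->
  \int[P]_w ((S j w - S i w) ^+ 4) <= K * (v i - v j) ^+ 2.

(* The maximum over a block is dominated by an explicit integrable function, so
   that no supremum has to be integrated.  The block is cut where v has lost
   half of its total decrease: each part then contributes at most 1/4 of the
   bound, and 3/2 * (1/4 + 1/4) < 1 leaves room for the middle increment. *)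
Lemma maximal_ineq (n i : nat) : exists G : T -> R,
  [/\ measurable_fun setT G, forall w, 0 <= G w,
    forall k w, (k <= n)%N -> (S (i + k) w - S i w) ^+ 4 <= G w &
    (\int[P]_w (G w)%:E <= (4 * c * K * (v i - v (i + n)) ^+ 2)%:E)%E].
Proof.
elim/ltn_ind: n i => n IH i.
have [->|n0] := eqVneq n 0%N.
  exists (fun=> 0); split => //.
    by move=> k w; rewrite leqn0 => /eqP ->; rewrite addn0 subrr expr0n.
  by rewrite integral0 addn0 subrr expr0n mulr0.
pose u := v i - v (i + n)%N.
have u0 : 0 <= u by rewrite subr_ge0 v_noninc// leq_addr.
(* Positivity of [m] is required separately because it makes the second block, of length [n - m],
   strictly shorter, even when [u] is 0. *)
pose cut m := (0 < m)%N && (u / 2 <= v i - v (i + m)%N).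
have exm : exists m, cut m.
  by exists n; rewrite /cut lt0n n0/= -/u; lra.
case: (ex_minnP exm) => m /andP[m0 um] minm.
have mn : (m <= n)%N by apply: minm; rewrite /cut lt0n n0/= -/u; lra.
have um1 : v i - v (i + m.-1)%N <= u / 2.
  have [m1|m1] := posnP m.-1; first by rewrite m1 addn0 subrr; lra.
  rewrite leNgt; apply/negP => lt.
  have := minm m.-1; rewrite /cut m1 (ltW lt) => /(_ isT).
  by rewrite leqNgt ltn_predL m0.
have um2 : v (i + m)%N - v (i + m + (n - m))%N <= u / 2.
  by rewrite -addnA subnKC//; move: um; rewrite /u; lra.
have vm1 : 0 <= v i - v (i + m.-1)%N by rewrite subr_ge0 v_noninc// leq_addr.
have vm2 : 0 <= v (i + m)%N - v (i + m + (n - m))%N.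
  by rewrite subr_ge0 v_noninc// leq_addr.
(* The two blocks run over the indices from i to i + m - 1 and from i + m to i + n. The jump at i +
   m belongs to neither, so minimality of [m] keeps the first decrease below u/2. *)
have [|G1 [mG1 G10 bG1 iG1]] := IH m.-1 _ i.
  by rewrite (leq_trans _ mn)// ltn_predL.
have [|G2 [mG2 G20 bG2 iG2]] := IH (n - m)%N _ (i + m)%N.
  by rewrite ltn_subrL m0 lt0n.
pose D w := (S (i + m) w - S i w) ^+ 4.
have LD : L4 P (fun w => S (i + m) w - S i w).
  under eq_fun do rewrite -mulN1r; apply: L4_add => //; exact: L4_scale.
have D0 w : 0 <= D w by rewrite exprn_even_ge0.
have mD : measurable_fun setT D by apply: measurable_funX; exact: (proj1 LD).
(* [D] is the jump from i to i + m, paid only when k >= m; the sum [G1 + G2] stands in for their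
   maximum. *)
exists (fun w => c * D w + 3 / 2 * (G1 w + G2 w)); split.
- apply: measurable_funD; apply: measurable_funM => //; exact: measurable_funD.
- by move=> w; rewrite addr_ge0// mulr_ge0 ?addr_ge0//; lra.
- move=> k w kn; case: (ltnP k m) => km.
    have : (S (i + k) w - S i w) ^+ 4 <= G1 w by apply: bG1; rewrite -ltnS prednK.
    by have := mulr_ge0 c0 (D0 w); have := G20 w; have := G10 w; lra.
  have := bG2 (k - m)%N w (leq_sub2r _ kn).
  rewrite -addnA subnKC// => H.
  have -> : S (i + k) w - S i w = (S (i + m) w - S i w) + (S (i + k) w - S (i + m) w).
    by ring.
  apply: le_trans (exprD4_le_c _ _) _.
  by rewrite -/(D w); have := G10 w; lra.
have -> : (\int[P]_w (c * D w + 3 / 2 * (G1 w + G2 w))%:E =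
    c%:E * \int[P]_w (D w)%:E +
    (3 / 2)%:E * (\int[P]_w (G1 w)%:E + \int[P]_w (G2 w)%:E))%E.
  rewrite (ge0_integral_linear mD (measurable_funD mG1 mG2))//; last first.
  - by move=> w; exact: addr_ge0.
  congr (_ + _ * _)%E; under eq_integral do rewrite EFinD.
  apply: ge0_integralD => //.
  - by move=> w _; rewrite lee_fin.
  - exact/measurable_EFinP.
  - by move=> w _; rewrite lee_fin.
  - exact/measurable_EFinP.
have iD : (\int[P]_w (D w)%:E <= (K * u ^+ 2)%:E)%E.
  have -> : (\int[P]_w (D w)%:E = (\int[P]_w D w)%:E)%E.
    by rewrite /Rintegral fineK//; exact: integrable_fin_num (proj2 LD).
  rewrite lee_fin (le_trans (incr (leq_addr m i)))// ler_wpM2l//.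
  rewrite ler_pXn2r ?nnegrE ?subr_ge0 ?v_noninc ?leq_addr// lerD2l lerN2 v_noninc//.
  by rewrite leq_add2l.
have half (x : R) : 0 <= x -> x <= u / 2 ->
    ((4 * c * K * x ^+ 2)%:E <= (4 * c * K * (u ^+ 2 / 4))%:E)%E.
  move=> x0 xu; rewrite lee_fin ler_wpM2l ?mulr_ge0//.
  have -> : u ^+ 2 / 4 = (u / 2) ^+ 2 by field.
  by rewrite ler_pXn2r ?nnegrE// (le_trans x0).
have iG1' := le_trans iG1 (half _ vm1 um1).
have iG2' := le_trans iG2 (half _ vm2 um2).
rewrite -/u; apply: le_trans.
  apply: leeD; first by apply: lee_wpmul2l iD; rewrite lee_fin.
  apply: lee_wpmul2l (leeD iG1' iG2'); rewrite lee_fin; lra.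
(* The constant C = 4c is the fixed point of C = c + (3/2)(C/4 + C/4), so the induction closes with
   equality. *)
rewrite -[leLHS]/((c * (K * u ^+ 2) +
  3 / 2 * (4 * c * K * (u ^+ 2 / 4) + 4 * c * K * (u ^+ 2 / 4)))%:E) lee_fin.
by rewrite le_eqVlt; apply/orP; left; apply/eqP; field.
Qed.

End MaximalInequality.

(** * Almost sure convergence from quartic increment bounds *)

Section AlmostSureConvergence.
Context {d : measure_display} {T : measurableType d} {R : realType}.
Variable P : probability T R.

(** The sum of the [H p] has integral at most M, hence is finite almost everywhere, and the terms of
    a convergent series tend to 0. *)
Lemma summable_integral_cvg0 (H : nat -> T -> R) (M : R) :
  (forall p, measurable_fun setT (H p)) -> (forall p w, 0 <= H p w) -> 0 <= M ->
  (forall p, \int[P]_w (H p w)%:E <= (M / (2 ^ p.+1)%:R)%:E)%E ->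
  {ae P, forall w, H ^~ w @ \oo --> (0 : R)}.
Proof.
move=> mH H0 M0 HM.
pose F w := (\sum_(p <oo) (H p w)%:E)%E.
have mHE p : measurable_fun setT (fun w => (H p w)%:E) by exact/measurable_EFinP.
have F0 w : (0 <= F w)%E by apply: nneseries_ge0 => p _ _; rewrite lee_fin.
have mF : measurable_fun setT F.
  by apply: ge0_emeasurable_sum => // k w _ _; rewrite lee_fin.
have iF : P.-integrable setT F.
  apply/integrableP; split => //.
  under eq_integral do rewrite gee0_abs//.
  rewrite integral_nneseries//; last by move=> n w _; rewrite lee_fin.
  apply: le_lt_trans (ltry M); apply: le_trans (epsilon_trick0 xpredT M0).
  apply: lee_nneseries => // p _ _.
  by apply: integral_ge0 => w _; rewrite lee_fin.
apply: filterS (integrable_ae measurableT iF) => w /(_ I) Fw.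
apply: cvg_series_cvg_0; apply: nondecreasing_is_cvgn.
  by apply: nondecreasing_series => n _ _; exact: H0.
exists (fine (F w)) => _ [n _ <-].
rewrite -lee_fin fineK// /series/= -sumEFin.
by apply: nneseries_lim_ge => k _ _; rewrite lee_fin.
Qed.

Variables (S : nat -> T -> R) (v : nat -> R) (K : R).
Hypothesis L4S : forall i, L4 P (S i).
Hypothesis v_noninc : forall i j, (i <= j)%N -> v j <= v i.
Hypothesis v_cvg0 : v @ \oo --> (0 : R).
Hypothesis K0 : 0 <= K.
Hypothesis incr : forall i j, (i <= j)%N ->
  \int[P]_w ((S j w - S i w) ^+ 4) <= K * (v i - v j) ^+ 2.
Hypothesis fourth : forall i, \int[P]_w (S i w ^+ 4) <= K * v i ^+ 2.

Lemma quartic_increments_cvg0 : {ae P, forall w, S ^~ w @ \oo --> (0 : R)}.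
Proof.
have v0 i : 0 <= v i.
  rewrite -(cvg_lim _ v_cvg0)//; apply: nonincreasing_cvgn_ge => //.
  by apply/cvg_ex; exists 0.
have small p : exists N, forall n, (N <= n)%N -> v n ^+ 2 <= ((2 ^ p.+1)%:R)^-1.
  have e0 : 0 < ((2 ^ p.+1)%:R)^-1 :> R by rewrite invr_gt0 ltr0n expn_gt0.
  have /cvgrPdist_le/(_ _ e0)[N _ HN] := v_cvg0.
  exists N => n Nn; have := HN n Nn; rewrite /= sub0r normrN ger0_norm// => vn.
  rewrite expr2 -[leRHS]mulr1 ler_pM// (le_trans vn)//.
  by rewrite invf_le1 ?ltr0n ?expn_gt0// ler1n expn_gt0.
have [f fP] := choice small.
(* The partial sums make [N] nondecreasing and at least [f p]; the added [p] makes it unbounded, so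
   the blocks between consecutive [N p] cover all large indices. *)
pose N p := (p + \sum_(q < p.+1) f q)%N.
have Np p : (f p <= N p)%N by rewrite /N big_ord_recr/= addnA leq_addl.
have NS p : (N p <= N p.+1)%N by rewrite /N [in leqRHS]big_ord_recr/= leq_add// leq_addr.
have [c c0 cP] := @exprD4_le_weighted R.
have := fun p => maximal_ineq L4S v_noninc K0 c0 cP incr (N p.+1 - N p) (N p).
move=> /choice[G GP].
(* By [exprD4_le], this dominates the fourth power of every S_k with k between [N p] and
   [N p.+1]. *)
pose H p w := 8 * G p w + 8 * S (N p) w ^+ 4.
have mS i : measurable_fun setT (fun w => S i w ^+ 4).
  by apply: measurable_funX; exact: (proj1 (L4S i)).
have mG p : measurable_fun setT (G p) by have [] := GP p.
have G0 p w : 0 <= G p w by have [_ /(_ w)] := GP p.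
have S0 i w : 0 <= S i w ^+ 4 by rewrite exprn_even_ge0.
have HM p : (\int[P]_w (H p w)%:E <= ((8 * (4 * c * K) + 8 * K) / (2 ^ p.+1)%:R)%:E)%E.
  rewrite ge0_integral_linear//.
  have iG : (\int[P]_w (G p w)%:E <= (4 * c * K * ((2 ^ p.+1)%:R)^-1)%:E)%E.
    have [_ _ _ /le_trans] := GP p; apply.
    rewrite lee_fin ler_wpM2l ?mulr_ge0// (le_trans _ (fP _ _ (Np p)))//.
    rewrite ler_pXn2r ?nnegrE ?subr_ge0 ?v_noninc ?leq_addr//.
    by rewrite lerBlDr lerDl.
  have iS : (\int[P]_w (S (N p) w ^+ 4)%:E <= (K * ((2 ^ p.+1)%:R)^-1)%:E)%E.
    have -> : (\int[P]_w (S (N p) w ^+ 4)%:E = (\int[P]_w (S (N p) w ^+ 4))%:E)%E.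
      by rewrite /Rintegral fineK//; exact: integrable_fin_num (proj2 (L4S _)).
    by rewrite lee_fin (le_trans (fourth _))// ler_wpM2l// fP.
  apply: le_trans.
    by apply: leeD; [apply: lee_wpmul2l iG|apply: lee_wpmul2l iS]; rewrite lee_fin.
  rewrite -[leLHS]/((8 * (4 * c * K * ((2 ^ p.+1)%:R)^-1) + 8 * (K * ((2 ^ p.+1)%:R)^-1))%:E).
  by rewrite lee_fin le_eqVlt; apply/orP; left; apply/eqP; ring.
apply: filterS (summable_integral_cvg0 _ _ _ HM); first last.
- by rewrite addr_ge0 ?mulr_ge0.
- by move=> p w; apply: addr_ge0; apply: mulr_ge0.
- by move=> p; apply: measurable_funD; apply: measurable_funM.
move=> w Hw; apply/cvgrPdist_lt => e e0.
have e40 : 0 < e ^+ 4 by rewrite exprn_gt0.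
have /cvgrPdist_lt/(_ _ e40)[p0 _ Hp0] := Hw.
exists (N p0) => // k /= Nk; rewrite sub0r normrN.
(* The block containing k starts at the largest [N q] not exceeding k; the search is bounded because
   q <= [N q]. *)
have exq : exists q, (N q <= k)%N by exists p0.
have ubq q : (N q <= k)%N -> (q <= k)%N by apply: leq_trans; exact: leq_addr.
case: (ex_maxnP exq ubq) => q Nq maxq.
have p0q : (p0 <= q)%N by exact: maxq.
have kN : (k < N q.+1)%N.
  by rewrite ltnNge; apply/negP => /maxq; rewrite ltnn.
have := Hp0 q p0q; rewrite /= sub0r normrN ger0_norm; last first.
  by apply: addr_ge0; apply: mulr_ge0.
have [_ _ /(_ (k - N q)%N w (leq_sub2r _ (ltnW kN))) + _] := GP q.
rewrite subnKC// => SG Hq.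
have : `|S k w| ^+ 4 < e ^+ 4.
  rewrite -normrX ger0_norm//; apply: le_lt_trans Hq.
  have -> : S k w = (S k w - S (N q) w) + S (N q) w by rewrite subrK.
  by apply: le_trans (exprD4_le _ _) _; rewrite mulrDr lerD2r ler_pM2l.
by rewrite ltr_pXn2r ?nnegrE// ltW.
Qed.

End AlmostSureConvergence.

(** * The Gaussian linear span of the process *)

Section GaussianSpan.
Context {d : measure_display} {T : measurableType d} {R : realType}.
Variable P : probability T R.

Lemma ip_comb (a b : R) (f g : T -> R) : L4 P f -> L4 P g ->
  ip P (fun w => a * f w + b * g w) (fun w => a * f w + b * g w) =
  a ^+ 2 * ip P f f + 2 * a * b * ip P f g + b ^+ 2 * ip P g g.
Proof.
move=> Lf Lg.
have Laf := L4_scale a Lf; have Lbg := L4_scale b Lg.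
rewrite ipDr//; last exact: L4_add.
rewrite !ipZr//; try exact: L4_add.
by rewrite 2!(ipC _ (fun w => a * f w + b * g w)) !ipDr// !ipZr// (ipC _ g f); ring.
Qed.

Lemma ip_cauchy_schwarz (f g : T -> R) : L4 P f -> L4 P g ->
  ip P f g ^+ 2 <= ip P f f * ip P g g.
Proof.
move=> Lf Lg.
have q (a b : R) : 0 <= a ^+ 2 * ip P f f + 2 * a * b * ip P f g + b ^+ 2 * ip P g g.
  by rewrite -ip_comb//; exact: ip_ge0.
have := ip_ge0 P g; rewrite le_eqVlt => /orP[/eqP g0|g0].
  (* With ip g g = 0 the form is affine in b; this b gives it the value -(ip f g)^2, which forces
     [ip P f g] to vanish. *)
  rewrite -g0 mulr0; have := q (ip P f g) (- (ip P f f + 1) / 2).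
  rewrite -g0 mulr0 addr0.
  have -> : ip P f g ^+ 2 * ip P f f + 2 * ip P f g * (- (ip P f f + 1) / 2) * ip P f g
    = - ip P f g ^+ 2 by field.
  by rewrite oppr_ge0.
have := q (ip P g g) (- ip P f g).
have -> : ip P g g ^+ 2 * ip P f f + 2 * ip P g g * - ip P f g * ip P f g +
    (- ip P f g) ^+ 2 * ip P g g =
  ip P g g * (ip P f f * ip P g g - ip P f g ^+ 2) by ring.
by rewrite pmulr_rge0// subr_ge0.
Qed.

Lemma ip_same_law (X Y : T -> R) :
  measurable_fun setT X -> measurable_fun setT Y ->
  (forall A : set R, measurable A -> P (X @^-1` A) = P (Y @^-1` A)) ->
  ip P X X = ip P Y Y.
Proof.
move=> mX mY XY.
pose X' : {mfun T >-> measurableTypeR R} :=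
  HB.pack X (isMeasurableFun.Build _ _ T (measurableTypeR R) X mX).
pose Y' : {mfun T >-> measurableTypeR R} :=
  HB.pack Y (isMeasurableFun.Build _ _ T (measurableTypeR R) Y mY).
pose sq (x : R) := (x ^+ 2)%:E.
have msq : measurable_fun setT sq by apply/measurable_EFinP; exact: measurable_funX.
have sq0 x : (0 <= sq x)%E by rewrite lee_fin sqr_ge0.
rewrite /ip /Rintegral; congr fine.
transitivity (\int[P]_w (sq (X w)))%E; first exact: eq_integral.
transitivity (\int[P]_w (sq (Y w)))%E; last exact: eq_integral.
rewrite -(@ge0_integral_distribution _ _ T (measurableTypeR R) R P X' sq)//.
rewrite -(@ge0_integral_distribution _ _ T (measurableTypeR R) R P Y' sq)//.
by apply: eq_measure_integral => A mA _; exact: XY.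
Qed.

Lemma fine_covarianceE (X Y : T -> R) :
  \int[P]_w X w = 0 -> \int[P]_w Y w = 0 ->
  fine (covariance P X Y) = ip P X Y.
Proof.
rewrite /Rintegral => X0 Y0; rewrite covariance.unlock expectation.unlock X0 Y0.
rewrite /ip /Rintegral; congr fine; apply: eq_integral => w _.
by rewrite -[LHS]/(((X w - 0) * (Y w - 0))%:E) !subr0.
Qed.

Variable B : R -> {RV P >-> R}.
Hypothesis gaussB : centered_gaussian_process B.

(** The Gaussian hypothesis applies directly to these functions, and stability under linear
    operations extends it to increments and estimation errors. *)
Definition gspan (f : T -> R) : Prop := exists (n : nat) (t c : 'I_n -> R),
  (forall i, 0 <= t i) /\ f = lincomb B t c.

Lemma gspan_process (t : R) : 0 <= t -> gspan (B t).
Proof.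
move=> t0; exists 1%N, (fun=> t), (fun=> 1); split => //.
by apply/funext => w; rewrite /lincomb big_ord1 mul1r.
Qed.

Lemma gspan_scale (a : R) (f : T -> R) : gspan f -> gspan (fun w => a * f w).
Proof.
move=> [n [t [c [t0 ->]]]]; exists n, t, (fun i => a * c i); split => //.
apply/funext => w; rewrite /lincomb mulr_sumr.
by apply: eq_bigr => i _; rewrite mulrA.
Qed.

Lemma gspan_add (f g : T -> R) : gspan f -> gspan g -> gspan (fun w => f w + g w).
Proof.
move=> [n [t [c [t0 ->]]]] [m [s [e [s0 ->]]]].
pose join (x : 'I_n -> R) (y : 'I_m -> R) (i : 'I_(n + m)) :=
  match fintype.split i with inl j => x j | inr j => y j end.
have joinl x y i : join x y (lshift m i) = x i.
  by rewrite /join -[lshift m i]/(unsplit (inl i)) unsplitK.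
have joinr x y i : join x y (rshift n i) = y i.
  by rewrite /join -[rshift n i]/(unsplit (inr i)) unsplitK.
exists (n + m)%N, (join t s), (join c e); split.
  by move=> i; rewrite /join; case: fintype.split.
apply/funext => w; rewrite /lincomb big_split_ord/=.
by congr (_ + _); apply: eq_bigr => i _; rewrite ?joinl ?joinr.
Qed.

Lemma gspan_sub (f g : T -> R) : gspan f -> gspan g -> gspan (fun w => f w - g w).
Proof.
move=> Lf Lg; have := gspan_add Lf (gspan_scale (-1) Lg).
by under eq_fun do rewrite mulN1r.
Qed.

Lemma gspan_sum (n : nat) (a : 'I_n -> R) (F : nat -> T -> R) :
  (forall i, gspan (F i)) -> gspan (fun w => \sum_(i < n) a i * F i w).
Proof.
move=> gF; elim: n a => [|n IH] a.
  exists 0%N, (fun=> 0), (fun=> 0); split => //.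
  by apply/funext => w; rewrite /lincomb !big_ord0.
under eq_fun do rewrite big_ord_recr/=.
by apply: gspan_add; [exact: IH|exact: gspan_scale].
Qed.

Lemma gspan_measurable (f : T -> R) : gspan f -> measurable_fun setT f.
Proof.
move=> [n [t [c [_ ->]]]]; apply: measurable_sum => i.
exact: measurable_funM.
Qed.

Lemma gspan_law (f : T -> R) : gspan f -> exists v, has_gaussian_law P f 0 v.
Proof. by move=> [n [t [c [t0 ->]]]]; exact: gaussB. Qed.

Lemma gspan_L4 (f : T -> R) : gspan f -> L4 P f.
Proof.
move=> gf; have [v lf] := gspan_law gf.
exact: gaussian_law_L4 (gspan_measurable gf) lf.
Qed.

Lemma gspan_mean (f : T -> R) : gspan f -> \int[P]_w f w = 0.
Proof.
move=> gf; have [v lf] := gspan_law gf.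
exact: gaussian_law_mean (gspan_measurable gf) lf.
Qed.

Lemma gspan_hypercontractive (f : T -> R) : gspan f ->
  \int[P]_w (f w ^+ 4) <= (256 * ip P f f) ^+ 2.
Proof.
move=> gf; have [v lf] := gspan_law gf.
exact: gaussian_law_hypercontractive (gspan_measurable gf) lf.
Qed.

Variable h : R.
Hypothesis h0 : 0 < h.
Notation xi := (incB B h).

Let timed_ge0 (k : nat) : 0 <= k%:R * h.
Proof. by rewrite mulr_ge0// ltW. Qed.

Lemma gspan_incB (k : nat) : gspan (xi k).
Proof. by apply: gspan_sub; exact: gspan_process. Qed.

(** * Toeplitz structure of the increment covariances *)

Section Stationarity.
Hypothesis statB : stationary_increments B.

(** Stationarity is available one linear combination at a time, so only squared norms transfer; the
    coefficient [e] prepares a polarization with e = 1 and e = -1. *)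
Lemma incB_stationary (i k : nat) (e : R) :
  ip P (fun w => 1 * xi i w + e * xi (i + k) w) (fun w => 1 * xi i w + e * xi (i + k) w) =
  ip P (fun w => 1 * B h w + e * xi k w) (fun w => 1 * B h w + e * xi k w).
Proof.
pose t (j : 'I_3) : R := nth 0 [:: h; k.+1%:R * h; k%:R * h] j.
pose c (j : 'I_3) : R := nth 0 [:: 1; e; - e] j.
have t0 j : 0 <= t j.
  by case: j => -[|[|[|//]]] jlt; rewrite /t/=; [exact: ltW|exact: timed_ge0|exact: timed_ge0].
have := statB (timed_ge0 i) c t0.
have -> : (fun w => \sum_(j < 3) c j * (B (t j + i%:R * h) w - B (i%:R * h) w)) =
    (fun w => 1 * xi i w + e * xi (i + k) w).
  apply/funext => w; rewrite !big_ord_recl big_ord0 /c /t /= /incB.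
  have -> : h + i%:R * h = i.+1%:R * h by rewrite -natr1; ring.
  have -> : k.+1%:R * h + i%:R * h = (i + k).+1%:R * h by rewrite -!natr1 natrD; ring.
  have -> : k%:R * h + i%:R * h = (i + k)%:R * h by rewrite natrD; ring.
  ring.
have -> : lincomb B t c = (fun w => 1 * B h w + e * xi k w).
  apply/funext => w; rewrite /lincomb !big_ord_recl big_ord0 /c /t /= /incB.
  ring.
have gB : gspan (B h) by apply: gspan_process; exact: ltW.
apply: ip_same_law; apply: gspan_measurable; apply: gspan_add;
  apply: gspan_scale => //; exact: gspan_incB.
Qed.

Lemma ip_incB (i k : nat) : ip P (xi i) (xi (i + k)) = ip P (xi k) (B h).
Proof.
have gB : gspan (B h) by apply: gspan_process; exact: ltW.
have L k' := gspan_L4 (gspan_incB k'); have LB := gspan_L4 gB.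
have := incB_stationary i k 1; have := incB_stationary i k (-1).
rewrite !ip_comb// (ipC _ (xi k)); lra.
Qed.

End Stationarity.

Lemma GammaE (N : nat) (i j : 'I_N) : Gamma B h N i j = ip P (xi i) (xi j).
Proof.
by rewrite mxE fine_covarianceE//; apply: gspan_mean; exact: gspan_incB.
Qed.

(** * Nonsingularity of the increment covariance matrix *)

Section Regularity.
Hypothesis B0 : {ae P, forall w, B 0 w = 0}.

Let b (k : nat) : T -> R := B (k%:R * h).

Lemma ip_origin (k : nat) : ip P (b 0) (b k) = 0.
Proof.
rewrite /ip /Rintegral (ae_eq_integral (cst 0%E))//.
- by rewrite integral0.
- by apply/measurable_EFinP; apply: measurable_funM.
- by apply: filterS B0 => w /= + _; rewrite /b mul0r => ->; rewrite mul0r.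
Qed.

(** Column k stands for time (k+1)h, so row 0 has no subtracted entry: the value at time 0 is taken
    to be 0. *)
Definition diff_mx (N : nat) : 'M[R]_N :=
  \matrix_(i < N, k < N) ((k == i)%:R - (k.+1 == i :> nat)%:R).

Lemma diff_mx_sum (N : nat) (i : 'I_N) (g : nat -> R) : g 0%N = 0 ->
  \sum_(k < N) diff_mx N i k * g k.+1 = g i.+1 - g i.
Proof.
move=> g0; under eq_bigr do rewrite mxE mulrBl.
rewrite sumrB; congr (_ - _).
  rewrite (bigD1 i)//= eqxx mul1r big1 ?addr0// => k /negbTE ->.
  by rewrite mul0r.
case: i => -[|i] lti /=.
  by rewrite g0 big1// => k _; rewrite mul0r.
rewrite (bigD1 (Ordinal (ltnW lti)))//= eqxx mul1r big1 ?addr0// => k ki.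
rewrite eqSS (_ : (k == i :> nat) = false) ?mul0r//.
by apply/negbTE; apply: contra ki => /eqP ki; apply/eqP/val_inj.
Qed.

Lemma diff_mx_unit (N : nat) : diff_mx N \in unitmx.
Proof.
rewrite unitmxE det_trig.
  rewrite big1 ?unitr1// => i _; rewrite mxE eqxx.
  by rewrite gtn_eqF ?subr0.
apply/is_trig_mxP => i j ij; rewrite mxE.
rewrite -val_eqE gtn_eqF//= gtn_eqF ?subrr//.
exact: ltnW.
Qed.

(** Bilinearity gives Gamma = D C D^T, with C the covariance matrix of the values of B and D the
    unitriangular difference matrix. *)
Lemma Gamma_unit (N : nat) : covB B h N \in unitmx -> Gamma B h N \in unitmx.
Proof.
move=> Cu; suff -> : Gamma B h N = diff_mx N *m covB B h N *m (diff_mx N)^T.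
  by rewrite !unitmx_mul unitmx_tr diff_mx_unit Cu.
have gb k : gspan (b k) by exact: gspan_process.
have Lb k := gspan_L4 (gb k).
apply/matrixP => i j; rewrite GammaE mxE.
have row (k l : 'I_N) : (diff_mx N *m covB B h N) k l =
    ip P (b k.+1) (b l.+1) - ip P (b k) (b l.+1).
  rewrite mxE -(diff_mx_sum k (g := fun m => ip P (b m) (b l.+1))); last exact: ip_origin.
  apply: eq_bigr => m _; rewrite [covB _ _ _ _ _]mxE fine_covarianceE//;
    apply: gspan_mean; exact: gb.
have E (f : T -> R) : L4 P f -> forall k, ip P f (xi k) = ip P f (b k.+1) - ip P f (b k).
  move=> Lf k; rewrite -[RHS](_ : ip P f (fun w => b k.+1 w + (-1) * b k w) = _).
    by apply: eq_Rintegral => w _; rewrite mulN1r.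
  rewrite ipDr//; last exact: L4_scale.
  by rewrite ipZr// mulN1r.
under eq_bigr do rewrite row [_^T _ _]mxE mulrC.
rewrite (diff_mx_sum j (g := fun m => ip P (b i.+1) (b m) - ip P (b i) (b m))); last first.
  by rewrite !(ipC _ _ (b 0)) !ip_origin subrr.
rewrite ipC E; last exact: (gspan_L4 (gspan_incB j)).
rewrite !(ipC _ (xi j)) !E//; ring.
Qed.

End Regularity.

End GaussianSpan.

(** * Row sums of a Toeplitz array *)

Section Averages.
Context {R : realType}.

(** Each distance |i - j| occurs at most twice: the indices before i give distances 1 to i, those
    from i on give 0 to N - i - 1. *)
Lemma sum_abs_index_le (a : nat -> R) (N i : nat) : (forall k, 0 <= a k) -> (i < N)%N ->
  \sum_(j < N) a (if (i <= j)%N then (j - i)%N else (i - j)%N) <= 2 * \sum_(k < N) a k.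
Proof.
move=> a0 iN.
have mono n : (n <= N)%N -> \sum_(0 <= k < n) a k <= \sum_(k < N) a k.
  move=> nN; rewrite -(big_mkord xpredT a) [leRHS](big_cat_nat (n := n))//=.
  by rewrite lerDl sumr_ge0.
rewrite -(big_mkord xpredT (fun j => a (if (i <= j)%N then (j - i)%N else (i - j)%N))).
rewrite (big_cat_nat (n := i))//=; last exact: ltnW.
rewrite mulrDl !mul1r; apply: lerD.
  have -> : \sum_(0 <= j < i) a (if (i <= j)%N then (j - i)%N else (i - j)%N) =
      \sum_(0 <= k < i) a k.+1.
    rewrite big_nat_rev/= add0n; apply: eq_big_nat => j /andP[_ ji].
    by rewrite leqNgt ltn_subrL (leq_ltn_trans (leq0n _) ji)/= subKn.
  apply: le_trans (mono i.+1 iN).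
  by rewrite [leRHS]big_nat_recl//= lerDr.
apply: le_trans (mono (N - i)%N (leq_subr _ _)).
rewrite -{1}(add0n i) big_addn; apply: ler_sum => j _.
by rewrite leq_addl addnK.
Qed.

End Averages.

(** * Covariances and convergence of the estimation error *)

Section MaximumLikelihood.
Context {d : measure_display} {T : measurableType d} {R : realType}.
Variables (P : probability T R) (B : R -> {RV P >-> R}) (h : R).
Hypothesis gaussB : centered_gaussian_process B.
Hypothesis statB : stationary_increments B.
Hypothesis h0 : 0 < h.
Hypothesis Gu : forall N, Gamma B h N \in unitmx.
Hypothesis cov_cvg0 : (fun k => ip P (incB B h k) (B h)) @ \oo --> (0 : R).
Notation xi := (incB B h).

Let weight (N : nat) : 'rV[R]_N := (zvec h N)^T *m invmx (Gamma B h N).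

(** Derivative of the Gaussian log-likelihood in theta at the true parameter; [info] is the Fisher
    information. *)
Let score (N : nat) (w : T) : R := \sum_(i < N) weight N 0 i * xi i w.

Let info (N : nat) : R := (weight N *m zvec h N) 0 0.

Definition mle_error (N : nat) (w : T) : R := (info N)^-1 * score N w.

Let Lxi k : L4 P (xi k).
Proof. by apply: (gspan_L4 gaussB); exact: gspan_incB. Qed.

Let gscore N : gspan B (score N).
Proof. by apply: gspan_sum => k; exact: gspan_incB. Qed.

Let Lscore N : L4 P (score N).
Proof. exact: gspan_L4 gaussB _ (gscore N). Qed.

Let infoE N : info N = \sum_(i < N) weight N 0 i * h.
Proof. by rewrite /info mxE; apply: eq_bigr => i _; rewrite [zvec _ _ _ _]mxE. Qed.

(** Normal equations before division by [info]: the weights times Gamma give back the row z^T. *)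
Let ip_incB_score N (j : 'I_N) : ip P (xi j) (score N) = h.
Proof.
rewrite ip_sumr//.
have : (weight N *m Gamma B h N) 0 j = h by rewrite mulmxKV// !mxE.
rewrite mxE => E; rewrite -[RHS]E; apply: eq_bigr => i _.
by rewrite GammaE// ipC.
Qed.

(** Only the shorter score is expanded: each of its increments also belongs to the longer sample and
    pairs with that score to h. *)
Let ip_score i j : (i <= j)%N -> ip P (score i) (score j) = info i.
Proof.
move=> ij; rewrite ipC ip_sumr// infoE; apply: eq_bigr => k _; congr (_ * _).
by rewrite ipC (ip_incB_score (widen_ord ij k)).
Qed.

Let info_ge (g : T -> R) N : L4 P g -> ip P g (score N) ^+ 2 <= ip P g g * info N.
Proof. by move=> Lg; rewrite -(ip_score (leqnn N)); exact: ip_cauchy_schwarz. Qed.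

(** Testing the Cauchy-Schwarz bound on the first increment gives h^2 <= 0 if [info] vanishes. The
    empty sample does have [info] equal to 0, hence the indexing by [N.+1]. *)
Let info_gt0 N : 0 < info N.+1.
Proof.
have := info_ge N.+1 (Lxi 0).
rewrite (ip_incB_score (ord0 : 'I_N.+1)) => H.
have i0 : 0 <= info N.+1 by rewrite -(ip_score (leqnn _)); exact: ip_ge0.
rewrite lt_neqAle i0 andbT; apply/eqP => i00; move: H; rewrite -i00 mulr0.
by rewrite leNgt exprn_gt0.
Qed.

Let mle_error_diff i j : (i <= j)%N ->
  ip P (fun w => mle_error j.+1 w - mle_error i.+1 w)
       (fun w => mle_error j.+1 w - mle_error i.+1 w) =
  (info i.+1)^-1 - (info j.+1)^-1.
Proof.
move=> ij.
have -> : (fun w => mle_error j.+1 w - mle_error i.+1 w) =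
    (fun w => (info j.+1)^-1 * score j.+1 w + (- (info i.+1)^-1) * score i.+1 w).
  by apply/funext => w; rewrite mulNr.
rewrite ip_comb// (ipC _ (score j.+1) (score i.+1)) !ip_score//.
by field; rewrite !gt_eqF.
Qed.

Let info_inv_noninc i j : (i <= j)%N -> (info j.+1)^-1 <= (info i.+1)^-1.
Proof. by move=> ij; rewrite -subr_ge0 -mle_error_diff//; exact: ip_ge0. Qed.

(* The left-hand side is the variance of the estimator; it is compared with that
   of the sample mean. *)
Let info_inv_le N : (info N.+1)^-1 <=
  2 / h ^+ 2 * arithmetic_mean (fun k => `|ip P (xi k) (B h)|) N.
Proof.
pose r k := ip P (xi k) (B h).
pose g w := \sum_(i < N.+1) 1 * xi i w.
have Lg : L4 P g by apply: (gspan_L4 gaussB); apply: gspan_sum => k; exact: gspan_incB.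
have gs : ip P g (score N.+1) = N.+1%:R * h.
  rewrite ipC ip_sumr//.
  under eq_bigr do rewrite mul1r ipC ip_incB_score.
  by rewrite sumr_const card_ord mulr_natl.
have gg : ip P g g <= N.+1%:R * (2 * \sum_(k < N.+1) `|r k|).
  rewrite ip_sumr//.
  have -> : N.+1%:R * (2 * \sum_(k < N.+1) `|r k|) =
      \sum_(i < N.+1) (2 * \sum_(k < N.+1) `|r k|).
    by rewrite sumr_const card_ord mulr_natl.
  apply: ler_sum => i _; rewrite mul1r ipC ip_sumr//.
  (* By stationarity, row i of the covariance matrix depends only on the distances |i - j|. *)
  apply: le_trans (sum_abs_index_le (a := fun k => `|r k|) _ (ltn_ord i)) => //.
  apply: ler_sum => j _; rewrite mul1r; apply: le_trans (ler_norm _) _.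
  case: (leqP i j) => [ij|/ltnW ji].
    by rewrite -{1}(subnKC ij) ip_incB.
  by rewrite ipC -{1}(subnKC ji) ip_incB.
have n0 : 0 < N.+1%:R :> R by rewrite ltr0n.
have := info_ge N.+1 Lg; rewrite gs => H.
rewrite -[leLHS]mul1r ler_pdivrMr// /arithmetic_mean seriesEord/=.
have -> : 2 / h ^+ 2 * (N.+1%:R^-1 * \sum_(k < N.+1) `|r k|) * info N.+1 =
  (N.+1%:R * (2 * \sum_(k < N.+1) `|r k|) * info N.+1) / (N.+1%:R * h) ^+ 2.
  by field; rewrite !gt_eqF.
rewrite ler_pdivlMr ?exprn_gt0 ?mulr_gt0// mul1r (le_trans H)//.
by rewrite ler_wpM2r// ltW.
Qed.

Let info_inv_cvg0 : (fun N => (info N.+1)^-1) @ \oo --> (0 : R).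
Proof.
have r0 : (fun k => `|ip P (xi k) (B h)|) @ \oo --> (0 : R).
  by rewrite -(@normr0 R R); exact: cvg_norm.
have a0 := cesaro r0.
have b0 : (fun N => 2 / h ^+ 2 * arithmetic_mean (fun k => `|ip P (xi k) (B h)|) N)
    @ \oo --> (0 : R).
  by rewrite -(mulr0 (2 / h ^+ 2)); apply: cvgM => //; exact: cvg_cst.
apply: (@squeeze_cvgr _ _ _ _ (fun=> 0)) b0; last exact: cvg_cst.
by apply: nearW => N; rewrite info_inv_le invr_ge0 ltW.
Qed.

Lemma mle_error_cvg0 : {ae P, forall w, (fun N => mle_error N.+1 w) @ \oo --> (0 : R)}.
Proof.
have ge N : gspan B (mle_error N) by exact: gspan_scale.
(* [K] is the square of the constant 256 relating fourth and second moments. *)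
apply: (quartic_increments_cvg0 (S := fun N => mle_error N.+1)
  (v := fun N => (info N.+1)^-1) (K := 256 ^+ 2)) => //.
- by move=> i; exact: (gspan_L4 gaussB).
- move=> i j ij; rewrite -exprMn -mle_error_diff//.
  by apply: (gspan_hypercontractive gaussB); exact: gspan_sub.
- move=> i; rewrite -exprMn.
  have -> : (info i.+1)^-1 = ip P (mle_error i.+1) (mle_error i.+1).
    rewrite -[mle_error i.+1]/(fun w => (info i.+1)^-1 * score i.+1 w).
    rewrite ipZr//; last exact: L4_scale.
    by rewrite ipC ipZr// ip_score//; field; rewrite gt_eqF.
  exact: (gspan_hypercontractive gaussB).
Qed.

Lemma mleE (theta : R) (N : nat) (w : T) :
  mle theta B h N.+1 w = theta + mle_error N.+1 w.
Proof.
rewrite /mle -/(weight _) -/(info _) /mle_error.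
have -> : (weight N.+1 *m DeltaX theta B h N.+1 w) 0 0 =
    theta * info N.+1 + score N.+1 w.
  rewrite mxE infoE mulr_sumr -big_split/=; apply: eq_bigr => i _.
  rewrite [DeltaX _ _ _ _ _ _ _]mxE /Xproc /incB -natr1; ring.
by field; rewrite gt_eqF.
Qed.

End MaximumLikelihood.

Unset Implicit Arguments.

Theorem theorem2p7 (d : measure_display) (T : measurableType d) (R : realType)
  (P : probability T R) (B : R -> {RV P >-> R}) (theta h : R) :
  centered_gaussian_process B ->
  stationary_increments B ->
  {ae P, forall w, B 0 w = 0} ->
  0 < h ->
  (forall N : nat, covB B h N \in unitmx) ->
  (fun k : nat =>
     fine 'E_P[(fun w => (B (k.+1%:R * h) w - B (k%:R * h) w) * B h w)%R])
    @ \oo --> (0 : R) ->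
  {ae P, forall w, (fun N : nat => mle theta B h N w) @ \oo --> theta}.
Proof.
move=> gaussB statB B0 h0 Cu; rewrite expectation.unlock => cov0.
have Gu N : Gamma B h N \in unitmx by exact: Gamma_unit.
apply: filterS (mle_error_cvg0 gaussB statB h0 Gu cov0) => w err0.
(* Shifting the index discards the empty sample, for which the decomposition of the estimator as
   theta plus its error is not established. *)
rewrite -cvg_shiftS; apply/subr_cvg0; apply: cvg_trans err0; apply: near_eq_cvg.
by apply: nearW => N /=; rewrite mleE// addrAC subrr add0r.
Qed.
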